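(* Let $q$ be a complex number with $|q|<1$, and let $a,b,c,d$ be complex numbers such that $|ad|<1$ and $|cq|<1$ (and such that none of the denominators below vanishes). Then \[ \sum_{n = 1}^{\infty} \frac{ (b/a;q)_n\, (c/d;q)_n\, (ad)^n }{ (b;q)_n\, (cq;q)_n } = \frac{(a-b)(d-c)}{ad-b}\sum_{m=0}^{\infty}\frac{(a;q)_m\, (bd/c;q)_m\, c^m}{(b;q)_m\, (ad;q)_m} \left(\frac{adq^m}{1-adq^m}-\frac{bq^m}{1-bq^m}\right). \]
   Context: For a complex number $A$ and $|q|<1$, the $q$-Pochhammer symbol is $(A;q)_0=1$, $(A;q)_n=(1-A)(1-Aq)\cdots(1-Aq^{n-1})$ for $n\ge 1$, and $(A;q)_\infty=\lim_{n\to\infty}(A;q)_n$. *)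

(* Defs.v *)
From Stdlib Require Import Reals.
From Coquelicot Require Import Coquelicot.

Local Open Scope C_scope.

Fixpoint qpoch (A q : C) (n : nat) : C :=
  match n with
  | O => RtoC 1
  | S k => qpoch A q k * (RtoC 1 - A * q ^ k)
  end.

(* [C] also carries a normed-module structure over [R] in Coquelicot; the one
   over itself is fixed here. *)
Definition is_Cseries (u : nat -> C) (l : C) : Prop :=
  @is_series C_AbsRing C_NormedModule u l.

(* Main.v *)
(** Put
      [U N m = (bq/a)_N (cq/d)_N (ad)^N (a)_m (bd/c)_m (cq)^m q^{mN}
               / ((cq)_N (b)_{m+N+1} (ad)_{m+1})],
      [V N m = U N m * (1 - ad q^m) / (1 - c q^{N+1})].
    Then [(a-b)(d-c) V N 0] is the term of index [N+1] on the left,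
    [(ad-b) U 0 m] is the term of index [m] on the right, and
      [U N m - U (N+1) m = V N m - V N (m+1)].
    Since [q]-Pochhammer symbols are bounded, and bounded away from [0] when
    they do not vanish, [U] and [V] are [O(|ad|^N |cq|^m)].  Summing over [m]
    shows that [S N = sum_m U N m] satisfies [S N - S (N+1) = V N 0], and
    summing over [N] gives [sum_N V N 0 = S 0]. *)

Require Import Defs.
From Stdlib Require Import Reals Lra Lia IndefiniteDescription.
From Coquelicot Require Import Coquelicot.

Local Open Scope C_scope.

(** * Boundedness of q-Pochhammer symbols and of their reciprocals *)

Lemma bounded_of_eventually_bounded (x : nat -> R) (N : nat) (B : R) :
  (forall n : nat, (N <= n)%nat -> (x n <= B)%R) ->
  exists B' : R, forall n : nat, (x n <= B')%R.
Proof.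
  revert B; induction N as [|N IH]; intros B HB.
  - exists B; intros n; apply HB; lia.
  - apply (IH (Rmax B (x N))); intros n Hn.
    destruct (Nat.eq_dec n N) as [->|Hne].
    + apply Rmax_r.
    + apply Rle_trans with B; [apply HB; lia | apply Rmax_l].
Qed.

(** Since 1 + t <= exp t, the accumulated growth factor is at most the exponential of a geometric
    sum, hence at most exp (M / (1 - r)). *)
Lemma bounded_of_geometric_growth (x : nat -> R) (M r : R) :
  (r < 1)%R -> (forall n : nat, (0 <= x n)%R) ->
  (0 <= M)%R -> (0 <= r)%R ->
  (forall n : nat, (x (S n) <= x n * (1 + M * r ^ n))%R) ->
  exists B : R, forall n : nat, (x n <= B)%R.
Proof.
  intros Hr Hx HM Hr0 Hstep.
  (* The exponent is M times the sum of r^k over k < n, in closed form, so each step adds exactly M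
     r^n. *)
  assert (H : forall n : nat,
    (x n <= x 0%nat * exp (M * ((1 - r ^ n) / (1 - r))))%R).
  { induction n as [|n IH].
    - simpl; replace (M * ((1 - 1) / (1 - r)))%R with 0%R by (field; lra).
      rewrite exp_0; lra.
    - replace (M * ((1 - r ^ S n) / (1 - r)))%R
        with (M * ((1 - r ^ n) / (1 - r)) + M * r ^ n)%R
        by (simpl; field; lra).
      rewrite exp_plus, <- Rmult_assoc.
      apply Rle_trans with (1 := Hstep n).
      apply Rmult_le_compat; [apply Hx | | exact IH | apply exp_ineq1_le].
      assert (0 <= M * r ^ n)%R
        by (apply Rmult_le_pos; [exact HM | apply pow_le; exact Hr0]).
      lra. }
  exists (x 0%nat * exp (M / (1 - r)))%R; intros n.
  apply Rle_trans with (1 := H n).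
  apply Rmult_le_compat_l; [apply Hx|].
  assert (M * ((1 - r ^ n) / (1 - r)) <= M / (1 - r))%R as Hle.
  { unfold Rdiv; apply Rmult_le_compat_l; [exact HM|].
    rewrite <- (Rmult_1_l (/ (1 - r))) at 2.
    apply Rmult_le_compat_r.
    - left; apply Rinv_0_lt_compat; lra.
    - assert (0 <= r ^ n)%R by (apply pow_le; exact Hr0); lra. }
  destruct Hle as [Hlt|Heq].
  - left; apply exp_increasing; exact Hlt.
  - rewrite Heq; apply Rle_refl.
Qed.

Lemma Cmod_one_minus_le (z : C) : (Cmod (1 - z) <= 1 + Cmod z)%R.
Proof.
  apply Rle_trans with (1 := Cmod_triangle _ _).
  rewrite Cmod_opp, Cmod_1; lra.
Qed.

Lemma Cmod_one_minus_ge (z : C) : (1 - Cmod z <= Cmod (1 - z))%R.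
Proof.
  assert (H := Cmod_triangle (1 - z) z).
  replace (1 - z + z) with (RtoC 1) in H by ring.
  rewrite Cmod_1 in H; lra.
Qed.

Lemma qpoch_bounded (A q : C) :
  (Cmod q < 1)%R ->
  exists B : R, forall n : nat, (Cmod (qpoch A q n) <= B)%R.
Proof.
  intros hq.
  apply bounded_of_geometric_growth with (M := Cmod A) (r := Cmod q);
    try apply Cmod_ge_0; [exact hq | intros n; apply Cmod_ge_0 |].
  intros n; simpl; rewrite Cmod_mult.
  apply Rmult_le_compat_l; [apply Cmod_ge_0|].
  rewrite <- Cmod_pow, <- Cmod_mult; apply Cmod_one_minus_le.
Qed.

Lemma qpoch_S_l (A q : C) (n : nat) :
  qpoch A q (S n) = (1 - A) * qpoch (A * q) q n.
Proof.
  induction n as [|n IH]; [simpl; ring|].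
  change (qpoch A q (S n) * (1 - A * q ^ S n)
          = (1 - A) * (qpoch (A * q) q n * (1 - A * q * q ^ n))).
  rewrite IH; simpl; ring.
Qed.

Lemma qpoch_factor_neq_0 (A q : C) (n : nat) :
  qpoch A q (S n) <> 0 -> 1 - A * q ^ n <> 0.
Proof.
  intros H E; apply H; simpl; rewrite E; ring.
Qed.

(** If c bounds every 1 / |1 - A q^n|, then each of these reciprocals is also at most 1 + c |A|
    |q|^n, so the growth lemma applies to the reciprocal symbols. *)
Lemma inv_qpoch_bounded (A q : C) :
  (Cmod q < 1)%R -> (forall n : nat, qpoch A q n <> 0) ->
  exists B : R, forall n : nat, (Cmod (/ qpoch A q n) <= B)%R.
Proof.
  intros hq hA.
  assert (hf : forall n, 1 - A * q ^ n <> 0)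
    by (intros n; apply qpoch_factor_neq_0, hA).
  assert (hpos : forall n, (0 < Cmod (1 - A * q ^ n))%R)
    by (intros n; apply Cmod_gt_0, hf).
  (* As |A q^n| tends to 0, it is eventually below 1/2, where the reciprocal is at most 2; the
     finitely many earlier values only enlarge the bound. *)
  assert (Hc : exists c, forall n, (/ Cmod (1 - A * q ^ n) <= c)%R).
  { assert (Hlim : is_lim_seq (fun n => Cmod A * Cmod q ^ n)%R 0).
    { replace (Finite 0) with (Rbar_mult (Cmod A) 0)
        by (simpl; f_equal; ring).
      apply is_lim_seq_scal_l, is_lim_seq_geom.
      rewrite Rabs_pos_eq; [exact hq | apply Cmod_ge_0]. }
    apply is_lim_seq_spec in Hlim.
    destruct (Hlim (mkposreal (1/2) ltac:(lra))) as [N HN]; simpl in HN.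
    apply bounded_of_eventually_bounded with (N := N) (B := 2%R).
    intros n Hn; specialize (HN n Hn).
    rewrite Rminus_0_r in HN; apply Rabs_lt_between in HN.
    assert (H := Cmod_one_minus_ge (A * q ^ n)).
    rewrite Cmod_mult, Cmod_pow in H.
    replace 2%R with (/ (/ 2))%R by field.
    apply Rinv_le_contravar; lra. }
  destruct Hc as [c Hc].
  assert (hc0 : (0 <= c)%R).
  { apply Rle_trans with (2 := Hc 0%nat).
    left; apply Rinv_0_lt_compat, hpos. }
  apply bounded_of_geometric_growth with (M := (c * Cmod A)%R) (r := Cmod q).
  - exact hq.
  - intros n; apply Cmod_ge_0.
  - apply Rmult_le_pos; [exact hc0 | apply Cmod_ge_0].
  - apply Cmod_ge_0.
  - intros n; rewrite !Cmod_inv by apply hA; simpl.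
    rewrite Cmod_mult, Rinv_mult.
    apply Rmult_le_compat_l.
    + left; apply Rinv_0_lt_compat, Cmod_gt_0, hA.
    + assert (H := Cmod_one_minus_ge (A * q ^ n)).
      rewrite Cmod_mult, Cmod_pow in H.
      specialize (hpos n); specialize (Hc n).
      set (y := Cmod (1 - A * q ^ n)) in *.
      set (z := (Cmod A * Cmod q ^ n)%R) in *.
      assert (0 <= z)%R
        by (apply Rmult_le_pos; [|apply pow_le]; apply Cmod_ge_0).
      replace (1 + c * Cmod A * Cmod q ^ n)%R with (1 + c * z)%R
        by (unfold z; ring).
      (* Dividing 1 - z <= y by y gives 1/y <= 1 + z/y, and 1/y <= c then gives 1/y <= 1 + c z. *)
      assert (/ y * (1 - z) <= / y * y)%R
        by (apply Rmult_le_compat_l; [left; apply Rinv_0_lt_compat|]; lra).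
      rewrite Rinv_l in H1 by lra.
      assert (/ y * z <= c * z)%R by (apply Rmult_le_compat_r; lra).
      lra.
Qed.

(** * Geometrically dominated and telescoping complex series *)

Lemma is_Cseries_unique (u : nat -> C) (l1 l2 : C) :
  is_Cseries u l1 -> is_Cseries u l2 -> l1 = l2.
Proof.
  apply (filterlim_locally_unique (K := C_AbsRing) (V := C_NormedModule)).
Qed.

(** Comparison with a geometric series. The explicit bound on the sum is what later makes the row
    sums decay. *)
Lemma is_Cseries_of_geometric_bound (u : nat -> C) (K r : R) :
  (0 <= r < 1)%R -> (forall n : nat, (Cmod (u n) <= K * r ^ n)%R) ->
  exists l : C, is_Cseries u l /\ (Cmod l <= K / (1 - r))%R.
Proof.
  intros Hr Hu.
  assert (Hg : is_series (fun n => K * r ^ n)%R (K / (1 - r))%R).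
  { apply (is_series_scal_l K (fun n => r ^ n)%R), is_series_geom.
    rewrite Rabs_pos_eq; lra. }
  destruct (ex_series_le (V := C_CompleteNormedModule) u
              (fun n => (K * r ^ n)%R)) as [l Hl].
  - exact Hu.
  - eexists; exact Hg.
  - exists l; split; [exact Hl|].
    apply (filterlim_le (F := eventually)
      (fun n => Cmod (sum_n (G := C_AbelianMonoid) u n))
      (fun n => sum_n (fun k => K * r ^ k)%R n) (Cmod l) (K / (1 - r))%R).
    + exists 0%nat; intros n _.
      induction n as [|n IH].
      * rewrite !sum_O; apply Hu.
      * rewrite !sum_Sn.
        apply Rle_trans with (1 := Cmod_triangle _ _).
        apply Rplus_le_compat; [exact IH | apply Hu].
    + apply (filterlim_comp _ _ _ _ Cmod _ _ _ Hl).
      apply (filterlim_norm (K := C_AbsRing) (V := C_NormedModule)).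
    + exact Hg.
Qed.

(** The partial sum up to index n is [V 0 - V (S n)], and the geometric bound sends the last term to
    0. *)
Lemma is_Cseries_telescope (u V : nat -> C) (K r : R) :
  (0 <= r < 1)%R -> (forall n : nat, (Cmod (V n) <= K * r ^ n)%R) ->
  (forall n : nat, u n = V n - V (S n)) ->
  is_Cseries u (V 0%nat).
Proof.
  intros Hr HV Hu.
  assert (Hlim : is_lim_seq (fun n => K * r ^ S n)%R 0).
  { apply is_lim_seq_incr_1 with (u := (fun n => K * r ^ n)%R).
    replace (Finite 0) with (Rbar_mult K 0) by (simpl; f_equal; ring).
    apply is_lim_seq_scal_l, is_lim_seq_geom.
    rewrite Rabs_pos_eq; lra. }
  assert (Hsum : forall n,
    sum_n (G := C_AbelianMonoid) u n = V 0%nat - V (S n)).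
  { induction n as [|n IH].
    - rewrite sum_O; apply Hu.
    - rewrite sum_Sn, IH, Hu.
      change (V 0%nat - V (S n) + (V (S n) - V (S (S n)))
              = V 0%nat - V (S (S n))); ring. }
  apply (filterlim_locally_ball_norm (K := C_AbsRing) (U := C_NormedModule)).
  intros eps.
  apply is_lim_seq_spec in Hlim.
  destruct (Hlim eps) as [N HN]; exists N; intros n Hn.
  specialize (HN n Hn); rewrite Rminus_0_r in HN.
  apply Rabs_lt_between in HN.
  unfold ball_norm.
  apply Rle_lt_trans with (2 := proj2 HN).
  apply Rle_trans with (2 := HV (S n)).
  rewrite Hsum.
  change (Cmod (V 0%nat - V (S n) - V 0%nat) <= Cmod (V (S n)))%R.
  replace (V 0%nat - V (S n) - V 0%nat) with (- V (S n)) by ring.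
  rewrite Cmod_opp; apply Rle_refl.
Qed.

(** The relation between [U] and [V] is a discrete closedness condition, which equates the sums
    along the two edges of the quadrant. Telescoping twice, first in m and then in N, avoids any
    interchange of summations. *)
Lemma is_Cseries_quadrant (U V : nat -> nat -> C) (K L r s : R) :
  (0 <= r < 1)%R -> (0 <= s < 1)%R ->
  (forall N m : nat, (Cmod (U N m) <= K * s ^ N * r ^ m)%R) ->
  (forall N m : nat, (Cmod (V N m) <= L * s ^ N * r ^ m)%R) ->
  (forall N m : nat, U N m - U (S N) m = V N m - V N (S m)) ->
  exists S0 : C, is_Cseries (U 0%nat) S0 /\ is_Cseries (fun N => V N 0%nat) S0.
Proof.
  intros Hr Hs HU HV HUV.
  assert (HS : forall N, exists l : C,
    is_Cseries (U N) l /\ (Cmod l <= K / (1 - r) * s ^ N)%R).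
  { intros N.
    destruct (is_Cseries_of_geometric_bound (U N) (K * s ^ N)%R r Hr (HU N))
      as [l [Hl Hb]].
    exists l; split; [exact Hl|].
    replace (K / (1 - r) * s ^ N)%R with (K * s ^ N / (1 - r))%R
      by (field; lra).
    exact Hb. }
  apply functional_choice in HS; destruct HS as [T HT].
  exists (T 0%nat); split; [apply HT|].
  apply is_Cseries_telescope with (K := (K / (1 - r))%R) (r := s).
  - exact Hs.
  - intros N; apply HT.
  - intros N.
    (* Both sides sum the same row of differences: one by linearity, the other by telescoping in
       m. *)
    apply is_Cseries_unique with (u := fun m => U N m - U (S N) m).
    + apply (is_Cseries_telescope _ (V N) (L * s ^ N)%R r Hr (HV N)).
      apply HUV.
    + apply (is_series_minus (K := C_AbsRing) (V := C_NormedModule));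
        apply HT.
Qed.

(** * Application to the two q-series *)

Lemma Cmod_mult_le (x y : C) (X Y : R) :
  (Cmod x <= X)%R -> (Cmod y <= Y)%R -> (Cmod (x * y) <= X * Y)%R.
Proof.
  intros Hx Hy; rewrite Cmod_mult.
  apply Rmult_le_compat; try apply Cmod_ge_0; assumption.
Qed.

Lemma Cmod_pow_le_1 (z : C) (n : nat) : (Cmod z < 1)%R -> (Cmod (z ^ n) <= 1)%R.
Proof.
  intros Hz; rewrite Cmod_pow, <- (pow1 n).
  apply pow_incr; split; [apply Cmod_ge_0 | lra].
Qed.

Theorem theorem2p1 (q a b c d : C)
  (hq : (Cmod q < 1)%R)
  (had : (Cmod (a * d) < 1)%R)
  (hcq : (Cmod (c * q) < 1)%R)
  (ha0 : a <> RtoC 0) (hd0 : d <> RtoC 0) (hc0 : c <> RtoC 0)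
  (hadb : a * d - b <> RtoC 0)
  (hb_poch : forall n : nat, qpoch b q n <> RtoC 0)
  (hcq_poch : forall n : nat, qpoch (c * q) q n <> RtoC 0)
  (had_poch : forall n : nat, qpoch (a * d) q n <> RtoC 0)
  (had_den : forall m : nat, RtoC 1 - a * d * q ^ m <> RtoC 0)
  (hb_den : forall m : nat, RtoC 1 - b * q ^ m <> RtoC 0) :
  exists L M : C,
    is_Cseries
      (fun k : nat =>
         let n := S k in
         qpoch (b / a) q n * qpoch (c / d) q n * (a * d) ^ n
           / (qpoch b q n * qpoch (c * q) q n)) L
    /\ is_Cseries
      (fun m : nat =>
         qpoch a q m * qpoch (b * d / c) q m * c ^ m
           / (qpoch b q m * qpoch (a * d) q m)
         * (a * d * q ^ m / (RtoC 1 - a * d * q ^ m)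
            - b * q ^ m / (RtoC 1 - b * q ^ m))) M
    /\ L = (a - b) * (d - c) / (a * d - b) * M.
Proof.
  destruct (qpoch_bounded (b / a * q) q hq) as [B1 H1].
  destruct (qpoch_bounded (c / d * q) q hq) as [B2 H2].
  destruct (qpoch_bounded a q hq) as [B3 H3].
  destruct (qpoch_bounded (b * d / c) q hq) as [B4 H4].
  destruct (inv_qpoch_bounded b q hq hb_poch) as [B5 H5].
  destruct (inv_qpoch_bounded (c * q) q hq hcq_poch) as [B6 H6].
  destruct (inv_qpoch_bounded (a * d) q hq had_poch) as [B7 H7].
  (* [U] and [V] differ only in the lengths of the symbols of cq and ad; leaving these as i and j
     lets one bound serve both. *)
  pose (W := fun N m i j : nat =>
    qpoch (b / a * q) q N * qpoch (c / d * q) q N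
    * qpoch a q m * qpoch (b * d / c) q m
    * / qpoch b q (S (m + N)) * / qpoch (c * q) q i * / qpoch (a * d) q j
    * (q ^ m) ^ N * (a * d) ^ N * (c * q) ^ m).
  (* The final 1 bounds the factor [(q ^ m) ^ N]. *)
  set (K := (B1 * B2 * B3 * B4 * B5 * B6 * B7 * 1)%R).
  assert (HW : forall N m i j,
    (Cmod (W N m i j) <= K * Cmod (a * d) ^ N * Cmod (c * q) ^ m)%R).
  { intros N m i j; unfold W.
    apply Cmod_mult_le; [|rewrite Cmod_pow; apply Rle_refl].
    apply Cmod_mult_le; [|rewrite Cmod_pow; apply Rle_refl].
    apply Cmod_mult_le.
    - repeat apply Cmod_mult_le; auto.
    - rewrite <- Cpow_mult_r; apply Cmod_pow_le_1, hq. }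
  destruct (is_Cseries_quadrant
              (fun N m => W N m N (S m)) (fun N m => W N m (S N) m)
              K K (Cmod (c * q)) (Cmod (a * d))) as [S0 [HU HV]].
  - split; [apply Cmod_ge_0 | exact hcq].
  - split; [apply Cmod_ge_0 | exact had].
  - intros N m; apply HW.
  - intros N m; apply HW.
  - intros N m; unfold W.
    rewrite Nat.add_succ_r, Nat.add_succ_l.
    assert (hbf := qpoch_factor_neq_0 _ _ _ (hb_poch (S (S (m + N))))).
    assert (hcf := qpoch_factor_neq_0 _ _ _ (hcq_poch (S N))).
    assert (hb1 := hb_poch (S (m + N))).
    assert (hadf := had_den m).
    (* Only the last factor of the longer symbol of b is exposed; the rest becomes an atom, so that
       what remains is a rational identity. *)
    change (qpoch b q (S (S (m + N))))
      with (qpoch b q (S (m + N)) * (1 - b * q ^ S (m + N))).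
    set (Pb := qpoch b q (S (m + N))) in *.
    simpl in *.
    rewrite !Cpow_mult_l, !Cpow_add_r in *.
    field.
    repeat split; auto.
  - exists ((a - b) * (d - c) * S0), ((a * d - b) * S0).
    repeat split.
    + apply (is_series_ext (K := C_AbsRing) (V := C_NormedModule))
        with (2 := is_series_scal (K := C_AbsRing) (V := C_NormedModule)
                     ((a - b) * (d - c)) _ _ HV).
      intros N; change scal with Cmult; unfold W.
      (* Splitting off the first factors leaves (1 - b/a)(1 - c/d), which times ad is (a - b)(d -
         c); this ad is the extra power in [(a * d) ^ S N]. *)
      rewrite !(qpoch_S_l (b / a)), !(qpoch_S_l (c / d)).
      simpl (0 + N)%nat.
      assert (hb1 := hb_poch (S N)); assert (hc1 := hcq_poch (S N)).
      set (Pb := qpoch b q (S N)) in *.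
      set (Pc := qpoch (c * q) q (S N)) in *.
      simpl; rewrite Cpow_1_l; field; auto.
    + apply (is_series_ext (K := C_AbsRing) (V := C_NormedModule))
        with (2 := is_series_scal (K := C_AbsRing) (V := C_NormedModule)
                     (a * d - b) _ _ HU).
      intros m; change scal with Cmult; unfold W.
      (* The difference of fractions equals (ad - b) q^m / ((1 - ad q^m)(1 - b q^m)): its q^m turns
         c^m into (cq)^m, and its denominators lengthen the symbols of ad and b by one. *)
      rewrite Nat.add_0_r, !Cpow_mult_l.
      assert (hb1 := hb_poch m); assert (hb2 := hb_den m).
      assert (ha1 := had_poch m); assert (ha2 := had_den m).
      simpl; field; auto.
    + field; exact hadb.
Qed.
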